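(* Let $\mathbb{F}_q$ be a finite field of characteristic $p$, and let $n$ be a prime number with $n\ne p$. Let $f:\{1,\ldots,n-1\}\to\mathbb{F}_q$ be a multiplicative function, i.e. $f$ is not identically zero and $f(ij \bmod n)=f(i)f(j)$ for all $i,j\in\{1,\ldots,n-1\}$, and extend $f$ to $\{1,\ldots,n\}$ by $f(n)=0$. Then $f$ is $D$-complicated.
   Context: Let $\mathbb{F}_q$ be a finite field with $q$ elements and let $n$ be a natural number. Let $M=\mathbb{F}_q^n$ be the set of all closed (cyclic) sequences $x=(x_1,\ldots,x_n)$ of $n$ elements of $\mathbb{F}_q$, with the convention $x_{n+1}=x_1$. The finite difference operator $\Delta:M\to M$ is defined by $(\Delta x)_i=x_{i+1}-x_i$, $i=1,\ldots,n$. A differential operator is any linear operator $D:M\to M$ representable in the form $D=\sum_{i=1}^m d_i\Delta^i$ with $m\ge 1$ and $d_i\in\mathbb{F}_q$ (no constant term). For a given $D$ and $x\in M$, the sequence $x,Dx,D^2x,\ldots$ is eventually periodic; its period is the length of the cycle it eventually enters, and its preperiod is the least $k\ge 0$ such that $D^kx$ lies on that cycle. A function $f:\{1,\ldots,n\}\to\mathbb{F}_q$ is identified with the sequence $x\in M$, $x_i=f(i)$. The function $f$ is called almost most complicated for $D$ if the period of $x,Dx,D^2x,\ldots$ is the maximum of the periods over all initial vectors in $M$, and the preperiod of $x,Dx,D^2x,\ldots$ differs by at most one from the maximum of the preperiods over all initial vectors in $M$. The function $f$ is called $D$-complicated if it is almost most complicated for every differential operator $D$. *)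

(* Defs.v *)
From HB Require Import structures.
From mathcomp Require Import all_boot all_order all_algebra.

Set Implicit Arguments.
Unset Strict Implicit.
Unset Printing Implicit Defensive.

Import GRing.Theory.
Local Open Scope ring_scope.

Section Dynamics.
Variables (T : finType) (D : T -> T).

Definition on_cycle (y : T) : bool := fconnect D (D y) y.

Lemma eventually_on_cycle (x : T) : exists k, on_cycle (iter k D x).
Proof.
have /trajectP[j lt_j e] := looping_order D x.
exists j; rewrite /on_cycle -iterS -[X in fconnect _ _ X]e -(subnK lt_j) iterD.
exact: fconnect_iter.
Qed.

Definition preperiod (x : T) : nat := ex_minn (eventually_on_cycle x).

(* [order D y] is the size of the forward orbit of y, hence the length of the
   cycle when y lies on it. *)
Definition period (x : T) : nat := order D (iter (preperiod x) D x).

Definition almost_most_complicated (x : T) : Prop :=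
  period x = (\max_(y : T) period y)%N /\
  (`|(\max_(y : T) preperiod y) - preperiod x| <= 1)%N.

End Dynamics.

Section CyclicSequences.
Variables (F : finFieldType) (n : nat).

(* The entry x_i of a cyclic sequence, i = 1, ..., n, is stored in column
   i - 1; [ordS] is the cyclic successor, so x_{n+1} = x_1. *)
Definition fdiff (x : 'rV[F]_n) : 'rV[F]_n := \row_i (x 0 (ordS i) - x 0 i).

Definition differential_operator (D : {linear 'rV[F]_n -> 'rV[F]_n}) : Prop :=
  exists (m : nat) (d : nat -> F), (1 <= m)%N /\
    forall x, D x = \sum_(1 <= i < m.+1) d i *: iter i fdiff x.

(* Functions on {1, ..., n} are represented by functions on nat, of which only
   the values at 1, ..., n are used. *)
Definition seq_of_fun (f : nat -> F) : 'rV[F]_n := \row_(i < n) f i.+1.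

Definition D_complicated (f : nat -> F) : Prop :=
  forall D : {linear 'rV[F]_n -> 'rV[F]_n},
    differential_operator D -> almost_most_complicated D (seq_of_fun f).

Definition multiplicative_fun (f : nat -> F) : Prop :=
  (exists2 i, (0 < i < n)%N & f i != 0) /\
  (forall i j, (0 < i < n)%N -> (0 < j < n)%N ->
     f ((i * j) %% n)%N = f i * f j).

Definition extend_by_zero (f : nat -> F) : nat -> F :=
  fun i => if i == n then 0 else f i.

End CyclicSequences.

(* Main.v *)
Require Import Defs.
From mathcomp Require Import all_boot all_order all_algebra.
From mathcomp Require Import closed_field.
Import GRing.Theory.
Local Open Scope ring_scope.

(** Cyclic sequences of length n are diagonalised, over an extension L of F
  that contains a primitive n-th root of unity, by the discrete Fourier
  transform: it turns the cyclic shift into multiplication by w^-1 at the n-th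
  root of unity w ([dft_fdiff]), hence a differential operator D into
  multiplication by a scalar c(w), with c(1) = 0 because D has no constant term
  ([dft_differential_operator]).  As n is prime to the characteristic, there
  are n such roots and the transform is injective ([dft_inj]).

  Being diagonalisable, D has no nilpotent part of index above 1: scalars with
  c^(k+r) = c^k also satisfy c^(1+r) = c, so that every preperiod is at most 1
  ([preperiod_differential_operator]) and the condition on preperiods holds for
  every sequence.

  For the periods, suppose that the transform of x vanishes nowhere except
  perhaps at 1.  An equality D^a x = D^b x with a, b > 0 then forces
  c(w)^a = c(w)^b at all w, the case w = 1 being c(1) = 0, so that
  D^a = D^b on all sequences ([iter_eq_transfer]) and the period of x is
  maximal ([period_le]).

  It remains to see that a multiplicative f has this property.  Up to the unit
  w, its transform at w is the Gauss sum G(w), the sum of f(i) w^i for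
  0 < i < n, and the substitution i -> k i mod n gives f(k) G(w^k) = G(w).
  All the w <> 1 are powers of one another and f(k) <> 0, so if G vanishes at
  one of them it vanishes at all.  Then the transform of f is supported at 1,
  which means that f is constant; but f(n) = 0 and f(1) <> 0. *)

(** * Periods and preperiods of a self-map of a finite type *)

Section Dynamics.
Context {T : finType}.
Implicit Types (D : T -> T) (x y : T).

Lemma preperiod_on_cycle D x : on_cycle D (iter (preperiod D x) D x).
Proof. by rewrite /preperiod; case: ex_minnP. Qed.

Lemma preperiod_le D k x : on_cycle D (iter k D x) -> (preperiod D x <= k)%N.
Proof. by rewrite /preperiod; case: ex_minnP => j _; apply. Qed.

Lemma on_cycleP D y :
  reflect (exists k, iter k.+1 D y = y) (on_cycle D y).
Proof.
apply: (iffP idP) => [/(orbitPcycle 2 3)%N // | ?].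
by apply/(orbitPcycle 3 2)%N.
Qed.

Lemma iter_mul_fixed {D y r} s : iter r D y = y -> iter (s * r) D y = y.
Proof. by move=> yr; elim: s => // s IHs; rewrite mulSn iterD IHs. Qed.

Lemma iter_fixed_shift {D y r} s :
  iter r D y = y -> iter r D (iter s D y) = iter s D y.
Proof. by move=> yr; rewrite -iterD addnC iterD yr. Qed.

Lemma order_le_return D y r :
  (0 < r)%N -> iter r D y = y -> (order D y <= r)%N.
Proof.
case: r => // r _ yr.
rewrite -(size_traject D y r.+1); apply: order_le_cycle (mem_head _ _).
by have := fpath_traject D y r.+1; rewrite trajectSr -iterSr yr.
Qed.

(** The return time r of the cycle entered by x gives an equality between two
  iterates at x, and its transfer to y says that r is a return time on the
  cycle entered by y.  Only positive exponents are asked for, as differential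
  operators need not be injective. *)
Lemma period_le D x y :
  (forall a b, (0 < a)%N -> (0 < b)%N ->
     iter a D x = iter b D x -> iter a D y = iter b D y) ->
  (period D y <= period D x)%N.
Proof.
move=> xy; set u := preperiod D x; set v := preperiod D y; set r := period D x.
have xr : iter r D (iter u D x) = iter u D x.
  by apply/(orbitPcycle 2 4)%N/preperiod_on_cycle.
have yr : iter r D (iter u.+1 D y) = iter u.+1 D y.
  by rewrite -iterD; apply: xy; rewrite ?addnS //= iterD xr.
have [s ws] := on_cycleP _ _ (preperiod_on_cycle D y).
apply: order_le_return; first exact: order_gt0.
(* The cycle entered by y is reached again from iter u.+1 D y, so the return
   time r passes to it. *)
have le_u : (u.+1 <= u.+1 * s.+1)%N by rewrite leq_pmulr.
have -> : iter (preperiod D y) D y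
    = iter (u.+1 * s.+1 - u.+1 + v) D (iter u.+1 D y).
  by rewrite -iterD addnAC subnK // iterD iter_mul_fixed.
exact: iter_fixed_shift.
Qed.

End Dynamics.

(** * Roots of unity and the discrete Fourier transform *)

(** Any root of 1 + X + ... + X^(n-1) will do: it is an n-th root of unity, and
  it is not 1 since n is nonzero in F; its order divides the prime n. *)
Lemma exists_prim_root (F : finFieldType) (n : nat) :
  prime n -> n%:R != 0 :> F ->
  exists (L : fieldType) (phi : {rmorphism F -> L}) (z : L),
    n.-primitive_root z.
Proof.
move=> n_prime nF; have n_gt1 := prime_gt1 n_prime.
have [L [phi _]] := countable_algebraic_closure F.
have [|z] := @closed_rootP L (\poly_(i < n) 1) _.
  by rewrite size_poly_eq ?oner_eq0 // neq_ltn n_gt1 orbT.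
rewrite /root horner_poly; under eq_bigr do rewrite mul1r.
move=> /eqP z0.
have zn : z ^+ n = 1.
  by apply/eqP; rewrite -subr_eq0 subrX1 z0 mulr0.
have z1 : z != 1.
  apply: contraNneq nF => z1; apply/eqP/(fmorph_inj phi).
  rewrite rmorph_nat rmorph0 -z0 -[in LHS](card_ord n) -sumr_const z1.
  by apply: eq_bigr => i _; rewrite expr1n.
exists L, phi, z.
have [m zm dvd_m] := prim_order_exists (ltnW n_gt1) zn.
case/primeP: n_prime => _ /(_ m dvd_m) /orP[]/eqP m_eq; last by rewrite -m_eq.
by move: z1; rewrite -(prim_expr_order zm) m_eq expr1 eqxx.
Qed.

Section Fourier.
Context {F : finFieldType} {L : fieldType} (phi : {rmorphism F -> L}) {n : nat}.
Implicit Types (x y : 'rV[F]_n) (w z : L).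

Definition dft x w : L := \sum_(j < n) phi (x 0 j) * w ^+ j.

(** The transform of x - y is a polynomial of degree less than n evaluated at
  the n distinct n-th roots of unity. *)
Lemma dft_inj {z x y} : n.-primitive_root z ->
  (forall w, w ^+ n = 1 -> dft x w = dft y w) -> x = y.
Proof.
move=> zP xy; apply/rowP => i.
(* [insub] turns the nat-valued index of \poly back into a column index. *)
pose p := \poly_(j < n) phi (if insub j is Some j' then x 0 j' - y 0 j' else 0).
have coefp j : p`_(j : 'I_n) = phi (x 0 j) - phi (y 0 j).
  by rewrite coef_poly ltn_ord valK rmorphB.
suff p0 : p = 0.
  by apply: (fmorph_inj phi); apply/eqP; rewrite -subr_eq0 -coefp p0 coef0.
apply/eqP; apply: contraT => pN0.
have := @max_poly_roots _ p [seq z ^+ nat_of_ord j | j <- enum 'I_n] pN0.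
rewrite size_map size_enum_ord ltnNge size_poly => absurd; apply: absurd.
  apply/allP => _ /mapP[j _ ->]; rewrite /root horner_poly; apply/eqP.
  have znj : (z ^+ j) ^+ n = 1 by rewrite exprAC (prim_expr_order zP) expr1n.
  transitivity (dft x (z ^+ j) - dft y (z ^+ j)); last by rewrite xy ?subrr.
  rewrite /dft -sumrB.
  by apply: eq_bigr => k _; rewrite valK rmorphB mulrBl.
rewrite map_inj_uniq ?enum_uniq // => j k /eqP.
by rewrite (eq_prim_root_expr zP) !modn_small ?ltn_ord // => /eqP /val_inj.
Qed.

Lemma dft_fdiff x w : w ^+ n = 1 -> dft (fdiff x) w = (w^-1 - 1) * dft x w.
Proof.
move=> wn; rewrite mulrBl mul1r {1}/dft.
under eq_bigr do rewrite mxE rmorphB mulrBl.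
rewrite sumrB; congr (_ - _).
rewrite [dft x w](reindex _ (onW_bij _ (ordS_bij n))) mulr_sumr.
apply: eq_bigr => i _; rewrite mulrCA /= (expr_mod _ wn) exprS mulKr //.
by rewrite -(unitrX_pos _ (leq_ltn_trans (leq0n i) (ltn_ord i))) wn unitr1.
Qed.

(** The scalar is the symbol of D, its defining polynomial evaluated at
  w^-1 - 1; it vanishes at w = 1 because D has no constant term. *)
Lemma dft_differential_operator {D : {linear 'rV[F]_n -> 'rV[F]_n}} {w} :
  differential_operator D -> w ^+ n = 1 ->
  exists2 c, (w = 1 -> c = 0) & forall x, dft (D x) w = c * dft x w.
Proof.
case=> m [d [_ Dd]] wn.
exists (\sum_(1 <= i < m.+1) phi (d i) * (w^-1 - 1) ^+ i) => [w1 | x].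
  rewrite big_nat big1 // => i /andP[i_gt0 _].
  by rewrite w1 invr1 subrr expr0n gtn_eqF // mulr0.
have dftI i : dft (iter i (@fdiff F n) x) w = (w^-1 - 1) ^+ i * dft x w.
  by elim: i => [|i IHi]; rewrite ?mul1r //= dft_fdiff // IHi exprS mulrA.
rewrite Dd mulr_suml /dft.
under eq_bigr do rewrite summxE rmorph_sum mulr_suml.
rewrite exchange_big; apply: eq_bigr => i _ /=.
rewrite -mulrA -dftI /dft mulr_sumr.
by apply: eq_bigr => j _; rewrite mxE rmorphM mulrA.
Qed.

Lemma dft_iter {D : {linear 'rV[F]_n -> 'rV[F]_n}} {w c} :
  (forall x, dft (D x) w = c * dft x w) ->
  forall k x, dft (iter k D x) w = c ^+ k * dft x w.
Proof.
by move=> Dc; elim=> [|k IHk] x; rewrite ?mul1r //= Dc IHk exprS mulrA.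
Qed.

(** On each Fourier coefficient D acts by a scalar c, and c is either 0 or
  cancellable: a periodicity that starts after k steps already starts after
  one. *)
Lemma preperiod_differential_operator {D : {linear 'rV[F]_n -> 'rV[F]_n}}
    {z} x :
  n.-primitive_root z -> differential_operator D -> (preperiod D x <= 1)%N.
Proof.
move=> zP DD; set k := preperiod D x.
apply: preperiod_le; apply/on_cycleP.
have [s /esym ks] := on_cycleP _ _ (preperiod_on_cycle D x).
exists s; apply: (dft_inj zP) => // w wn.
have [c _ Dc] := dft_differential_operator DD wn.
have := congr1 (dft^~ w) ks; rewrite !(dft_iter Dc) => e.
rewrite expr1 mulrCA.
have [->|c0] := eqVneq c 0; first by rewrite !mul0r.
by congr (_ * _); apply: (mulfI (expf_neq0 k c0)); rewrite mulrCA -e.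
Qed.

(** Where the transform of x is nonzero, an equality between iterates at x is
  an equality between powers of the scalar by which D acts; at w = 1 this
  scalar is 0 and both positive powers vanish. *)
Lemma iter_eq_transfer {D : {linear 'rV[F]_n -> 'rV[F]_n}} {z x y a b} :
  n.-primitive_root z -> differential_operator D ->
  (forall w, w ^+ n = 1 -> w != 1 -> dft x w != 0) ->
  (0 < a)%N -> (0 < b)%N -> iter a D x = iter b D x -> iter a D y = iter b D y.
Proof.
move=> zP DD x0 a0 b0 xab; apply: (dft_inj zP) => // w wn.
have [c c1 Dc] := dft_differential_operator DD wn.
rewrite !(dft_iter Dc).
have [/c1 ->|w1] := eqVneq w 1; first by rewrite !expr0n !gtn_eqF.
congr (_ * _); apply: (mulIf (x0 w wn w1)).
by rewrite -!(dft_iter Dc) xab.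
Qed.

End Fourier.

(** * Gauss sums of multiplicative functions *)

Section MultiplicativeFunction.
Context {F : finFieldType} {L : fieldType} (phi : {rmorphism F -> L}) {n : nat}.
Context {f : nat -> F}.
Hypotheses (n_prime : prime n) (f_mult : multiplicative_fun n f).

Let n_gt0 : (0 < n)%N := prime_gt0 n_prime.

Definition gauss_sum (w : L) : L :=
  \sum_(i < n | (0 < i)%N) phi (f i) * w ^+ i.

(** The factor w makes up for the entry f(i) being stored in column i - 1. *)
Lemma dft_gauss w : w ^+ n = 1 ->
  w * dft phi (seq_of_fun n (extend_by_zero n f)) w = gauss_sum w.
Proof.
move=> wn; rewrite /dft /gauss_sum mulr_sumr.
case: n n_gt0 => // n' _.
rewrite big_ord_recr [RHS]big_mkcond big_ord_recl /= add0r.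
rewrite !mxE /extend_by_zero eqxx rmorph0 mul0r mulr0 addr0.
by apply: eq_bigr => i _; rewrite mxE eqSS ltn_eqF //= mulrCA -exprS.
Qed.

Lemma coprime_lt_prime {k} : (0 < k < n)%N -> coprime n k.
Proof.
by case/andP=> k0 kn; rewrite prime_coprime // gtnNdvd.
Qed.

Lemma modn_mul_gt0 {k i} :
  (0 < k < n)%N -> (0 < (k * i) %% n)%N = (0 < i %% n)%N.
Proof.
by move=> kn; rewrite !lt0n; congr (~~ _); exact/Gauss_dvdr/coprime_lt_prime.
Qed.

Definition dilate k (i : 'I_n) : 'I_n := Ordinal (ltn_pmod (k * i) n_gt0).

Lemma dilate_inj k : (0 < k < n)%N -> injective (dilate k).
Proof.
move=> kn.
have inj (i j : 'I_n) : (i <= j)%N -> dilate k i = dilate k j -> i = j.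
  move=> le_ij /(congr1 val) /= /esym/eqP.
  rewrite eqn_mod_dvd ?leq_mul2l ?le_ij ?orbT // -mulnBr.
  rewrite Gauss_dvdr ?coprime_lt_prime // -eqn_mod_dvd //.
  by rewrite !modn_small // => /eqP /val_inj.
move=> i j e; case/orP: (leq_total i j) => /inj; first exact.
by move=> h; apply/esym/h.
Qed.

(** Some f(i) is nonzero and i = k j mod n for some j, whence
  f(k) f(j) = f(i). *)
Lemma multiplicative_neq0 {k} : (0 < k < n)%N -> f k != 0.
Proof.
move=> kn; case: f_mult => -[i /andP[i0 ni] fi] fM.
have [g _ gK] := injF_bij (dilate_inj _ kn).
pose j := g (Ordinal ni).
have kj : (k * j %% n = i)%N by have /(congr1 val) := gK (Ordinal ni).
have j0 : (0 < j < n)%N.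
  by rewrite ltn_ord andbT -(modn_small (ltn_ord j)) -(modn_mul_gt0 kn) kj.
by apply: contraNneq fi => fk; rewrite -kj fM // fk mul0r.
Qed.

(** The substitution i -> k i mod n in the sum that defines [gauss_sum w]. *)
Lemma gauss_sum_dilate {k w} : (0 < k < n)%N -> w ^+ n = 1 ->
  phi (f k) * gauss_sum (w ^+ k) = gauss_sum w.
Proof.
move=> kn wn; rewrite [RHS](reindex_inj (dilate_inj _ kn)) mulr_sumr.
apply: eq_big => [i | i i0] /=; first by rewrite modn_mul_gt0 // modn_small.
case: f_mult => _ ->; rewrite ?i0 ?ltn_ord //.
by rewrite (expr_mod _ wn) exprM rmorphM mulrA.
Qed.

(** The relation [gauss_sum_dilate] ties the Gauss sum at each nontrivial power
  of z to the one at z through the nonzero factors f(k). *)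
Lemma gauss_sum_eq0 {z w v : L} : n.-primitive_root z ->
  w ^+ n = 1 -> w != 1 -> v ^+ n = 1 -> v != 1 ->
  gauss_sum w = 0 -> gauss_sum v = 0.
Proof.
move=> zP wn w1 vn v1 Gw.
have zn := prim_expr_order zP.
have expo u : u ^+ n = 1 -> u != 1 -> {k | (0 < k < n)%N & u = z ^+ k}.
  move=> /(prim_rootP zP)[k uk] u1; exists k => //.
  by rewrite ltn_ord andbT lt0n; apply: contraNneq u1 => k0; rewrite uk k0.
have [k kn wk] := expo w wn w1; have [l ln vl] := expo v vn v1.
apply/eqP; have := gauss_sum_dilate ln zn.
rewrite -(gauss_sum_dilate kn zn) -wk Gw mulr0 -vl => /eqP.
by rewrite mulf_eq0 fmorph_eq0 (negPf (multiplicative_neq0 ln)).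
Qed.

(** Otherwise all coefficients at w <> 1 vanish, hence so does the transform of
  the difference sequence, and f would be cyclically constant. *)
Lemma dft_multiplicative_neq0 {z w : L} : n.-primitive_root z ->
  w ^+ n = 1 -> w != 1 ->
  dft phi (seq_of_fun n (extend_by_zero n f)) w != 0.
Proof.
move=> zP wn w1; set x := seq_of_fun _ _; apply/negP => /eqP xw.
have Gw : gauss_sum w = 0 by rewrite -dft_gauss // xw mulr0.
have unity_neq0 (v : L) : v ^+ n = 1 -> v != 0.
  by move=> vn; rewrite -unitfE -(unitrX_pos _ n_gt0) vn unitr1.
have dx0 : fdiff x = 0.
  apply: (dft_inj phi zP) => // v vn; rewrite dft_fdiff //.
  have -> : dft phi (0 : 'rV_n) v = 0.
    by rewrite /dft; apply: big1 => i _; rewrite mxE rmorph0 mul0r.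
  have [->|v1] := eqVneq v 1; first by rewrite invr1 subrr mul0r.
  have /eqP := gauss_sum_eq0 zP wn w1 vn v1 Gw.
  rewrite -dft_gauss // mulf_eq0 (negPf (unity_neq0 v vn)) /= => /eqP ->.
  exact: mulr0.
have n_gt1 := prime_gt1 n_prime.
have last_lt : (n.-1 < n)%N by rewrite prednK.
(* The last entry of the difference sequence is f(1) - f(n) = f(1). *)
have /rowP/(_ (Ordinal last_lt)) := dx0.
rewrite !mxE /extend_by_zero /= prednK // modnn eqxx subr0 ltn_eqF //.
by apply/eqP; apply: multiplicative_neq0.
Qed.

End MultiplicativeFunction.

Theorem theorem3 (F : finFieldType) (p : nat) (charFp : p \in [pchar F])
    (n : nat) (n_prime : prime n) (n_neq_p : n != p)
    (f : nat -> F) (f_mult : multiplicative_fun n f) :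
  D_complicated n (extend_by_zero n f).
Proof.
move=> D DD; set x := seq_of_fun _ _.
have nF : n%:R != 0 :> F.
  rewrite -(dvdn_pcharf charFp) dvdn_prime2 // 1?eq_sym //.
  by have /andP[] := charFp.
have [L [phi [z zP]]] := exists_prim_root F n n_prime nF.
split.
  apply/eqP; rewrite eqn_leq leq_bigmax; apply/bigmax_leqP => y _.
  apply: period_le => a b; apply: (iter_eq_transfer phi zP DD) => w.
  exact: (dft_multiplicative_neq0 phi n_prime f_mult zP).
have max_le1 : (\max_y preperiod D y <= 1)%N.
  apply/bigmax_leqP => y _; exact: (preperiod_differential_operator phi y zP).
by rewrite distnEl ?leq_bigmax // (leq_trans (leq_subr _ _)).
Qed.
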